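(* Let $G$ be a graph that contains an induced $(n,m)$-necklace with $n\ge 5$ and $m\ge 1$ whose cycle has good neighbours in $G$. Then $G$ diverges under the operator $KB_e$, i.e. $\lim_{k\to\infty}|V(KB_e^k(G))|=\infty$.
   Context: All graphs are finite, simple and undirected. A biclique of a graph $G$ is a maximal (with respect to inclusion) induced subgraph of $G$ that is a complete bipartite graph $K_{p,q}$ with $p,q\ge 1$. The edge-biclique graph $KB_e(G)$ has one vertex for each biclique of $G$, two distinct vertices being adjacent iff the corresponding bicliques share at least one edge; $KB_e^0(G)=G$, $KB_e^k(G)=KB_e(KB_e^{k-1}(G))$. For $n\ge3$, $m\ge1$, the $(n,m)$-necklace is the graph on $n+m$ vertices consisting of an induced cycle $C_n$ and a complete graph $K_m$ such that, for one fixed edge $xy$ of the cycle, every vertex of the $K_m$ is adjacent to $x$ and $y$ and to no other vertex of the cycle. An induced cycle $C=v_0\ldots v_{n-1}$ ($n\ge5$) of a graph $H$ has good neighbours in $H$ if for every vertex $v\in V(H)\setminus V(C)$ and every $i$ (indices mod $n$), $\{v_{i-1},v_{i+1}\}\subseteq N(v)$ implies $v_i\in N(v)$. *)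

(* Defs.v *)
From mathcomp Require Import all_boot.
Set Implicit Arguments. Unset Strict Implicit. Unset Printing Implicit Defensive.

Record sgraph := SGraph {
  vert :> finType;
  adj : rel vert;
  adj_sym : symmetric adj;
  adj_irr : irreflexive adj }.

Section Bicliques.
Variable G : sgraph.

Definition is_cbip (S : {set G}) : bool :=
  [exists X : {set G}, exists Y : {set G},
    [&& X != set0, Y != set0, [disjoint X & Y], S == X :|: Y,
        [forall x in X, forall y in Y, adj x y],
        [forall x in X, forall x' in X, ~~ adj x x'] &
        [forall y in Y, forall y' in Y, ~~ adj y y']]].

Definition is_biclique (S : {set G}) : bool :=
  is_cbip S && [forall S' : {set G}, ((S \subset S') && is_cbip S') ==> (S' == S)].

Definition biclique := {S : {set G} | is_biclique S}.

(* Two bicliques share an edge uv of G (both ends in both bicliques;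
   the bicliques are induced subgraphs). *)
Definition share_edge (B1 B2 : biclique) : bool :=
  [exists u : G, exists v : G,
    [&& adj u v, u \in val B1, v \in val B1, u \in val B2 & v \in val B2]].

Definition kbe_adj : rel biclique := fun B1 B2 => (B1 != B2) && share_edge B1 B2.

Lemma kbe_adj_sym : symmetric kbe_adj.
Proof.
move=> B1 B2; rewrite /kbe_adj eq_sym; congr (_ && _).
by apply/existsP/existsP => -[u /existsP [v /and5P [a b c d e]]];
   exists u; apply/existsP; exists v; apply/and5P; split.
Qed.

Lemma kbe_adj_irr : irreflexive kbe_adj.
Proof. by move=> B; rewrite /kbe_adj eqxx. Qed.

End Bicliques.

Definition KBe (G : sgraph) : sgraph :=
  @SGraph (biclique G) (@kbe_adj G) (@kbe_adj_sym G) (@kbe_adj_irr G).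

Definition KBe_iter (k : nat) (G : sgraph) : sgraph := iter k KBe G.

Definition has_good_necklace (G : sgraph) (n m : nat) : Prop :=
  exists (c : 'I_n -> G) (w : 'I_m -> G) (i0 : 'I_n),
    [/\ injective c, injective w & (forall i a, c i != w a)] /\
    [/\ (forall i j, adj (c i) (c j) = (j == ordS i) || (i == ordS j)),
         (forall a b, adj (w a) (w b) = (a != b)) &
         (forall a i, adj (w a) (c i) = (i == i0) || (i == ordS i0))] /\
    (forall (v : G) (i : 'I_n), (forall j, v != c j) ->
        adj v (c (ord_pred i)) -> adj v (c (ordS i)) -> adj v (c i)).

(* Main.v *)
Require Import Defs.
From mathcomp Require Import all_boot.

Set Implicit Arguments. Unset Strict Implicit. Unset Printing Implicit Defensive.

(**
  Let [c] be a good cycle and let [W_i] be the set of vertices whose neighbours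
  on the cycle are exactly [c_i] and [c_(i+1)]. Good neighbours force every
  biclique [B_i] containing the path [c_(i-1) c_i c_(i+1)] to be a star centred
  at [c_i], and it follows that [B] is a good cycle of [KBe G]. A biclique
  containing [c_i] and [c_(i+1)] but neither [c_(i-1)] nor [c_(i+2)] lies in the
  corresponding set [W'_i] of [KBe G], and [W'_i] is a clique, as all its members
  contain the edge [c_i c_(i+1)].  Each [t] in [W_i] therefore gives a biclique
  [L t] through [c_(i-1), c_i, t] in [W'_(i-1)] and a biclique [R t] through
  [t, c_(i+1), c_(i+2)] in [W'_(i+1)]. When [G] is itself the edge-biclique graph
  of a graph with a good cycle, [L t] and [R t'] never share an edge, so the
  bicliques which [L t] and [R t'] induce in [W''_i] one step later are distinct:
  the size of [W_i] doubles every two steps.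
*)

(** * Bicliques as two-coloured vertex sets *)

Section Bicliques.
Variable G : sgraph.
Implicit Types (S : {set G}) (D : biclique G).

(** With sides encoded as Boolean colours, later claims about triangles or opposite sides of a
    biclique become case analyses on Booleans. *)
Lemma cbip_colouring S : is_cbip S ->
  exists f : G -> bool, {in S &, forall x y, adj x y = f x (+) f y}.
Proof.
case/existsP=> X /existsP[Y /and5P[_ _ dXY /eqP-> /and3P[aXY iX iY]]].
have aXYE x y : x \in X -> y \in Y -> adj x y.
  by move=> xX yY; move/forall_inP/(_ x xX)/forall_inP/(_ y yY): aXY.
have iXE x y : x \in X -> y \in X -> adj x y = false.
  by move=> xX yX; apply/negbTE; move/forall_inP/(_ x xX)/forall_inP/(_ y yX): iX.
have iYE x y : x \in Y -> y \in Y -> adj x y = false.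
  by move=> xX yX; apply/negbTE; move/forall_inP/(_ x xX)/forall_inP/(_ y yX): iY.
exists (mem X) => x y; rewrite !inE /=.
have [xX _|_ /= xY] := boolP (x \in X);
  have [yX _|_ /= yY] := boolP (y \in X) => //=.
- by rewrite iXE.
- by rewrite aXYE.
- by rewrite adj_sym aXYE.
- by rewrite iYE.
Qed.

(** The edge between [a] and [b] guarantees that both colour classes are inhabited. *)
Lemma colouring_cbip S (f : G -> bool) a b :
  {in S &, forall x y, adj x y = f x (+) f y} ->
  a \in S -> b \in S -> adj a b -> is_cbip S.
Proof.
move=> fS aS bS ab.
suff wlog_col g : {in S &, forall x y, adj x y = g x (+) g y} -> g a -> is_cbip S.
  case fa: (f a); first exact: wlog_col fS fa.
  apply: (wlog_col (fun x => ~~ f x)); last by rewrite fa.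
  by move=> x y xS yS; rewrite fS //; case: (f x); case: (f y).
move=> gS ga; move: ab; rewrite gS // ga /= => gb.
apply/existsP; exists [set x in S | g x]; apply/existsP; exists [set x in S | ~~ g x].
apply/and5P; split.
- by apply/set0Pn; exists a; rewrite inE aS.
- by apply/set0Pn; exists b; rewrite inE bS.
- by rewrite disjoint_subset; apply/subsetP=> x; rewrite !inE => /andP[-> ->].
- by apply/eqP/setP=> x; rewrite !inE; case: (x \in S); case: (g x).
apply/and3P; split; apply/forall_inP=> x; rewrite inE => /andP[xS gx];
  apply/forall_inP=> y; rewrite inE => /andP[yS gy]; rewrite gS //.
- by rewrite gx (negbTE gy).
- by rewrite gx gy.
- by rewrite (negbTE gx) (negbTE gy).
Qed.

Lemma biclique_colouring D :
  exists f : G -> bool, {in val D &, forall x y, adj x y = f x (+) f y}.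
Proof. by apply: cbip_colouring; case/andP: (valP D). Qed.

Lemma cbip_extend S : is_cbip S -> exists D, S \subset val D.
Proof.
move=> /maxset_exists[S' /maxsetP[cS' mS'] sSS'].
have bS' : is_biclique S'.
  rewrite /is_biclique cS'; apply/forallP=> T; apply/implyP=> /andP[sT cT].
  by apply/eqP; apply: mS'.
by exists (Sub S' bS').
Qed.

Lemma path_extend (a b d : G) : adj a b -> adj b d -> ~~ adj a d ->
  exists D, [/\ a \in val D, b \in val D & d \in val D].
Proof.
move=> ab bd /negbTE ad.
have nab : a == b = false by apply/eqP=> e; rewrite e adj_irr in ab.
have ndb : d == b = false by apply/eqP=> e; rewrite e adj_irr in bd.
have [|D /subsetP sD] := @cbip_extend [set a; b; d].
  (* The middle vertex [b] alone forms one side of the path. *)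
  apply: (@colouring_cbip _ (pred1 b) a b) => //; rewrite ?inE ?eqxx ?orbT //.
  move=> x y; rewrite !inE /= => /orP[/orP[]|] /eqP-> /orP[/orP[]|] /eqP->;
    by rewrite ?eqxx ?nab ?ndb ?adj_irr ?ab ?bd ?ad // adj_sym ?ab ?bd ?ad.
by exists D; split; apply: sD; rewrite !inE eqxx ?orbT.
Qed.

(** Two distinct elements of [T] with the same image would form a triangle with [x] inside one
    biclique. *)
Lemma clique_biclique_inj (T : {set G}) (x : G) (U : G -> biclique G) :
  {in T &, forall t t', t != t' -> adj t t'} ->
  {in T, forall t, [/\ adj t x, t \in val (U t) & x \in val (U t)]} ->
  {in T &, injective U}.
Proof.
move=> cT UE t t' tT t'T e; apply/eqP/idPn=> /(cT _ _ tT t'T).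
have [tx tU xU] := UE t tT; have [t'x t'U _] := UE t' t'T.
have [f fE] := biclique_colouring (U t); move: t'U; rewrite -e => t'U.
by move: tx t'x; rewrite !fE //; case: (f t); case: (f t'); case: (f x).
Qed.

Lemma KBe_adjP D1 D2 : reflect
  (D1 <> D2 /\ exists u v : G, [/\ adj u v, u \in val D1, v \in val D1,
                                  u \in val D2 & v \in val D2])
  (@adj (KBe G) D1 D2).
Proof.
apply: (iffP andP) => -[/eqP ne].
  case/existsP=> u /existsP[v /and5P[uv u1 v1 u2 v2]].
  by split=> //; exists u, v; split.
case=> u [v [uv u1 v1 u2 v2]]; split=> //.
by apply/existsP; exists u; apply/existsP; exists v; apply/and5P.
Qed.

End Bicliques.

(** * Distinctness of nearby indices modulo n *)

Section CyclicIndices.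
Variable n : nat.
Hypothesis n_ge5 : 5 <= n.
Implicit Types i j : 'I_n.

Lemma iter_ordS_neq k i : 0 < k < 5 -> iter k (@ordS n) i != i.
Proof.
case/andP=> k0 k5; apply/eqP => /(congr1 val).
have -> : val (iter k (@ordS n) i) = (i + k) %% n.
  elim: k {k0 k5} => [|k IH]; first by rewrite addn0 modn_small.
  by rewrite iterS /= IH -addn1 modnDml -addnA addn1.
have kn : k < n by apply: leq_trans n_ge5.
move=> /= e; have := modn_small (ltn_ord i); rewrite -{2}e => /eqP.
rewrite -{1}[val i]addn0 eqn_modDl modn_small ?(leq_trans _ n_ge5) //.
by rewrite modn_small // eq_sym -leqn0 leqNgt k0.
Qed.

Lemma ordS_neq i :
  [/\ (ordS i == i = false) * (i == ordS i = false),
      (ordS (ordS i) == i = false) * (i == ordS (ordS i) = false),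
      (ordS (ordS (ordS i)) == i = false) * (i == ordS (ordS (ordS i)) = false) &
      (ordS (ordS (ordS (ordS i))) == i = false)
      * (i == ordS (ordS (ordS (ordS i))) = false)].
Proof.
by split; split; rewrite 1?[i == _]eq_sym; apply/negbTE;
  [apply: (@iter_ordS_neq 1)|apply: (@iter_ordS_neq 1)
  |apply: (@iter_ordS_neq 2)|apply: (@iter_ordS_neq 2)
  |apply: (@iter_ordS_neq 3)|apply: (@iter_ordS_neq 3)
  |apply: (@iter_ordS_neq 4)|apply: (@iter_ordS_neq 4)].
Qed.

Definition ordSE i :=
  let: And4 h1 h2 h3 h4 := ordS_neq i in (h1, h2, h3, h4).

Definition ordS_eq := inj_eq (can_inj (@ordSK n)).

End CyclicIndices.

(** * Good cycles and the vertices attached to their edges *)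

Definition good_cycle n (G : sgraph) (c : 'I_n -> G) : Prop :=
  [/\ injective c,
      forall i j, adj (c i) (c j) = (j == ordS i) || (i == ordS j) &
      forall (v : G) i, (forall j, v != c j) ->
        adj v (c (ord_pred i)) -> adj v (c (ordS i)) -> adj v (c i)].

(** For a good cycle with n >= 5 such a [t] lies off the cycle, since the two neighbours of a cycle
    vertex are not consecutive. *)
Definition edge_nbrs n (G : sgraph) (c : 'I_n -> G) (i : 'I_n) : {set G} :=
  [set t | [forall j, adj t (c j) == ((j == i) || (j == ordS i))]].

(** The two extra clauses are not assumed of the given graph, but one application of [KBe] provides
    them. The clique clause makes the choice of bicliques injective; the last clause keeps left and
    right bicliques from sharing an edge. *)
Definition strong_cycle n (G : sgraph) (c : 'I_n -> G) : Prop :=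
  [/\ good_cycle c,
      forall i, {in edge_nbrs c i &, forall t t', t != t' -> adj t t'} &
      forall q i t, t \in edge_nbrs c (ordS i) ->
        adj q (c i) -> adj q (c (ordS (ordS (ordS i)))) -> ~~ adj q t].

(** * Bicliques through the edges of a good cycle *)

Section GoodCycle.
Variables (n : nat) (G : sgraph) (c : 'I_n -> G).
Hypothesis n_ge5 : 5 <= n.
Hypothesis gc : good_cycle c.
Implicit Types (i j : 'I_n) (D : biclique G).

Lemma cycle_adj i j : adj (c i) (c j) = (j == ordS i) || (i == ordS j).
Proof. by case: gc. Qed.

Let E := (cycle_adj, ordS_eq, ordSE n_ge5, eqxx).

Lemma edge_nbrsP i t : reflect
  (forall j, adj t (c j) = (j == i) || (j == ordS i)) (t \in edge_nbrs c i).
Proof. by rewrite inE; apply: (iffP forallP) => h j; apply/eqP; rewrite h. Qed.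

(** Covers vertices of the cycle as well: since n >= 5, only c_(i+1) is next to both c_i and c_(i+2)
    there. *)
Lemma good_middle i v :
  adj v (c i) -> adj v (c (ordS (ordS i))) -> v = c (ordS i) \/ adj v (c (ordS i)).
Proof.
move=> v1 v2; have [/existsP[j /eqP vj]|/existsPn nv] := boolP [exists j, v == c j].
  left; rewrite vj; congr c; move: v1 v2; rewrite vj !cycle_adj !ordS_eq.
  by case/orP=> /eqP->; rewrite ?E //= => /eqP->.
by right; case: gc => _ _; apply=> //; rewrite ordSK.
Qed.

Lemma edge_nbrs_right i t : t \in edge_nbrs c i -> exists D,
  [/\ t \in val D, c (ordS i) \in val D & c (ordS (ordS i)) \in val D].
Proof.
move/edge_nbrsP=> tE; apply: path_extend.
- by rewrite tE eqxx orbT.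
- by rewrite !E.
- by rewrite tE !E.
Qed.

Lemma edge_nbrs_left i t : t \in edge_nbrs c (ordS i) -> exists D,
  [/\ t \in val D, c i \in val D & c (ordS i) \in val D].
Proof.
move/edge_nbrsP=> tE; have [||| D [h1 h2 h3]] := @path_extend _ t (c (ordS i)) (c i).
- by rewrite tE eqxx.
- by rewrite !E.
- by rewrite tE !E.
- by exists D.
Qed.

Lemma edge_nbrs_non_crossing i t t' D D' :
  (forall q, adj q (c i) -> adj q (c (ordS (ordS (ordS i)))) -> ~~ adj q t) ->
  t \in edge_nbrs c (ordS i) -> t' \in edge_nbrs c (ordS i) ->
  [/\ t \in val D, c i \in val D & c (ordS i) \in val D] ->
  [/\ t' \in val D', c (ordS (ordS i)) \in val D'
                   & c (ordS (ordS (ordS i))) \in val D'] ->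
  ~~ @adj (KBe G) D D'.
Proof.
move=> far /edge_nbrsP tE /edge_nbrsP t'E [tD c0D c1D] [t'D c2D c3D].
apply/negP=> /KBe_adjP[_ [u [v [uv uD vD uD' vD']]]].
have [f fE] := biclique_colouring D; have [g gE] := biclique_colouring D'.
(* Exactly one end of the shared edge is on the side of c_(i+1) in [D]. This end sees c_i and [t]
   but not c_(i+1). *)
have [q [qD qD' fq]] : exists q, [/\ q \in val D, q \in val D' & f q = f (c (ordS i))].
  move: uv; rewrite fE //; case eu: (f u == f (c (ordS i))).
    by exists u; split=> //; apply/eqP.
  move=> uv; exists v; split=> //.
  by move: eu uv; case: (f u); case: (f v); case: (f (c _)).
have f0 : f (c i) (+) f (c (ordS i)) by rewrite -fE // !E.
have ft : f t (+) f (c (ordS i)) by rewrite -fE // tE !E.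
have q0 : adj q (c i) by rewrite fE // fq addbC.
have qt : adj q t by rewrite fE // fq addbC.
have q1 : adj q (c (ordS i)) = false by rewrite fE // fq addbb.
have g23 : g (c (ordS (ordS i))) (+) g (c (ordS (ordS (ordS i)))).
  by rewrite -gE // !E.
have gt' : g t' (+) g (c (ordS (ordS i))) by rewrite -gE // t'E !E orbT.
(* In [D'] the vertex [q] sees one of c_(i+2), c_(i+3). The latter is excluded by [far]; the former
   forces q = c_(i+1). *)
have [q3|q3] := boolP (adj q (c (ordS (ordS (ordS i))))).
  by move: (far q q0 q3); rewrite qt.
have q2 : adj q (c (ordS (ordS i))).
  rewrite gE //; move: q3; rewrite gE //.
  by move: g23; case: (g (c _)); case: (g (c _)); case: (g q).
case: (good_middle q0 q2) => [eq|]; last by rewrite q1.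
(* Now q = c_(i+1), [t'] and c_(i+2) form a triangle in [D']. *)
have : g t' (+) g q by rewrite -gE // eq t'E !E.
move: gt'; have := q2; rewrite gE //.
by case: (g (c _)); case: (g t'); case: (g q).
Qed.

(** The star is indexed by [ordS i], its centre, so that index computations involve successors
    only. *)
Lemma star_family : exists B : 'I_n -> biclique G, forall i,
  [/\ c i \in val (B (ordS i)), c (ordS i) \in val (B (ordS i))
    & c (ordS (ordS i)) \in val (B (ordS i))].
Proof.
have [i|B BE] := @fin_all_exists _ (fun=> biclique G) (fun i D =>
   [/\ c (ord_pred i) \in val D, c i \in val D & c (ordS i) \in val D]).
  by rewrite -[i]ord_predK ordSK; apply: path_extend; rewrite !E.
by exists B => i; have [] := BE (ordS i); rewrite ordSK.
Qed.

Lemma edge_nbrs_right_fun i :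
  {in edge_nbrs c i &, forall t t', t != t' -> adj t t'} ->
  exists2 U : G -> biclique G, {in edge_nbrs c i &, injective U} &
    forall t, t \in edge_nbrs c i ->
    [/\ t \in val (U t), c (ordS i) \in val (U t) & c (ordS (ordS i)) \in val (U t)].
Proof.
move=> clq; have [t|U UE] := @fin_all_exists _ (fun=> biclique G)
   (fun t D => t \in edge_nbrs c i ->
   [/\ t \in val D, c (ordS i) \in val D & c (ordS (ordS i)) \in val D]).
  have [/edge_nbrs_right[D hD]|_] := boolP (t \in edge_nbrs c i); first by exists D.
  (* Outside [edge_nbrs c i] the value is arbitrary. *)
  by have [B _] := star_family; exists (B i).
exists U => //; apply: (clique_biclique_inj clq (x := c (ordS i))) => t tT.
have [tU cU _] := UE t tT; split=> //.
by move/edge_nbrsP: tT => ->; rewrite eqxx orbT.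
Qed.

Lemma edge_nbrs_left_fun i :
  {in edge_nbrs c (ordS i) &, forall t t', t != t' -> adj t t'} ->
  exists2 U : G -> biclique G, {in edge_nbrs c (ordS i) &, injective U} &
    forall t, t \in edge_nbrs c (ordS i) ->
    [/\ t \in val (U t), c i \in val (U t) & c (ordS i) \in val (U t)].
Proof.
move=> clq; have [t|U UE] := @fin_all_exists _ (fun=> biclique G)
   (fun t D => t \in edge_nbrs c (ordS i) ->
   [/\ t \in val D, c i \in val D & c (ordS i) \in val D]).
  have [/edge_nbrs_left[D hD]|_] := boolP (t \in edge_nbrs c (ordS i)).
    by exists D.
  by have [B _] := star_family; exists (B i).
exists U => //; apply: (clique_biclique_inj clq (x := c (ordS i))) => t tT.
have [tU _ cU] := UE t tT; split=> //.
by move/edge_nbrsP: tT => ->; rewrite eqxx.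
Qed.

(** * The cycle of stars in the edge-biclique graph *)

Section StarFamily.
Variable B : 'I_n -> biclique G.
Hypothesis B_path : forall i,
  [/\ c i \in val (B (ordS i)), c (ordS i) \in val (B (ordS i))
    & c (ordS (ordS i)) \in val (B (ordS i))].

Lemma star_mem i : c i \in val (B i).
Proof. by rewrite -[i]ord_predK; case: (B_path (ord_pred i)). Qed.

Lemma star_memS i : c (ordS i) \in val (B i).
Proof. by rewrite -[i]ord_predK; case: (B_path (ord_pred i)). Qed.

Lemma star_memP i : c i \in val (B (ordS i)).
Proof. by case: (B_path i). Qed.

Let M := (star_mem, star_memS, star_memP).

(** A vertex on the side of c_i sees both c_(i-1) and c_(i+1), so [good_middle] makes it c_i or a
    neighbour of c_i; being on the same side excludes the latter. *)
Lemma star_centre i u : u \in val (B i) -> u = c i \/ adj u (c i).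
Proof.
rewrite -[i]ord_predK; move: (ord_pred i) => {}i uB.
have [f fE] := biclique_colouring (B (ordS i)).
case eu: (adj u (c (ordS i))); first by right.
left; case: (@good_middle i u).
- rewrite fE ?M //; move: eu; rewrite fE ?M //.
  have: adj (c i) (c (ordS i)) by rewrite !E.
  by rewrite fE ?M //; case: (f u); case: (f (c _)); case: (f (c _)).
- rewrite fE ?M //; move: eu; rewrite fE ?M //.
  have: adj (c (ordS (ordS i))) (c (ordS i)) by rewrite !E.
  by rewrite fE ?M //; case: (f u); case: (f (c _)); case: (f (c _)).
- by [].
- by rewrite eu.
Qed.

(** Every edge of a star contains its centre, in particular a shared one. *)
Lemma star_adj_mem i D : @adj (KBe G) D (B i) ->
  c i \in val D /\ exists u, [/\ u \in val D, u \in val (B i) & adj u (c i)].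
Proof.
case/KBe_adjP=> _ [u [v [uv uD vD uB vB]]].
have [f fE] := biclique_colouring (B i).
have [eu|au] := star_centre uB.
  by rewrite -eu; split=> //; exists v; split=> //; rewrite adj_sym.
have [ev|av] := star_centre vB.
  by rewrite -ev; split=> //; exists u; split.
move: uv au av; rewrite !fE ?M //.
by case: (f u); case: (f v); case: (f (c _)).
Qed.

Lemma star_adj i D u : D <> B i -> c i \in val D -> u \in val D ->
  u \in val (B i) -> adj u (c i) -> @adj (KBe G) D (B i).
Proof. by move=> ne cD uD uB uc; apply/KBe_adjP; split=> //; exists u, (c i); rewrite M. Qed.

Lemma star_neqS i : B i <> B (ordS i).
Proof.
move=> e; have := star_memS (ordS i); rewrite -e => /star_centre[/eqP|].
  by rewrite (inj_eq (let: And3 h _ _ := gc in h)) !E.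
by rewrite !E.
Qed.

Lemma star_cycle_adj i j : @adj (KBe G) (B i) (B j) = (j == ordS i) || (i == ordS j).
Proof.
apply/idP/orP=> [a|].
  have [cj _] := star_adj_mem a.
  have [/eqP|] := star_centre cj.
    rewrite (inj_eq (let: And3 h _ _ := gc in h)) => /eqP e.
    by move: a; rewrite e adj_irr.
  by rewrite cycle_adj orbC => /orP.
have aS k : @adj (KBe G) (B k) (B (ordS k)).
  apply: (@star_adj _ _ (c k)); rewrite ?M //; first exact: star_neqS.
  by rewrite !E.
by case=> /eqP->; [|rewrite adj_sym]; apply: aS.
Qed.

Lemma star_inj : injective B.
Proof.
move=> i j e; have := star_mem i; rewrite e => /star_centre[|].
  by case: gc => inj _ _ /inj.
rewrite cycle_adj -star_cycle_adj e.
by rewrite adj_irr.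
Qed.

Lemma star_good_cycle : @good_cycle n (KBe G) B.
Proof.
split; [exact: star_inj | exact: star_cycle_adj |] => D k.
rewrite -[k]ord_predK ordSK; move: (ord_pred k) => i nD.
move=> /star_adj_mem[c0 [u [uD uB u0]]] /star_adj_mem[c2 _].
have [f fE] := biclique_colouring D.
have [g gE] := biclique_colouring (B i).
(* The nonadjacent c_i and c_(i+2) are on one side of [D], so the leaf [u] of [B i] sees both.
   Either u = c_(i+1), and [D] shares the edge c_i c_(i+1) with the middle star, or u, c_i, c_(i+1)
   is a triangle in [B i]. *)
have u2 : adj u (c (ordS (ordS i))).
  have: ~~ adj (c i) (c (ordS (ordS i))) by rewrite !E.
  move: u0; rewrite !fE //.
  by case: (f u); case: (f (c _)); case: (f (c _)).
have [e|u1] := good_middle u0 u2.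
  apply: (@star_adj _ _ (c i)); rewrite ?M //.
  - exact/eqP.
  - by rewrite -e.
  - by rewrite !E.
have: adj (c i) (c (ordS i)) by rewrite !E.
move: u0 u1; rewrite !gE ?M //.
by case: (g u); case: (g (c _)); case: (g (c _)).
Qed.

Lemma edge_nbrs_KBe i D :
  c (ordS i) \in val D -> c (ordS (ordS i)) \in val D ->
  c i \notin val D -> c (ordS (ordS (ordS i))) \notin val D ->
  D \in @edge_nbrs n (KBe G) B (ordS i).
Proof.
move=> c1 c2 c0 c3; rewrite inE; apply/forallP=> j; apply/eqP.
have [f fE] := biclique_colouring D.
have f12 : f (c (ordS i)) (+) f (c (ordS (ordS i))) by rewrite -fE // !E.
apply/idP/orP=> [/star_adj_mem[cj _]|].
  (* c_(i+1) and c_(i+2) are on opposite sides of [D], so c_j sees one of them; this leaves the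
     indices i to i+3, whose extremes are excluded. *)
  have : adj (c j) (c (ordS i)) || adj (c j) (c (ordS (ordS i))).
    rewrite !fE //; move: f12.
    by case: (f _); case: (f _); case: (f _).
  rewrite !cycle_adj !ordS_eq.
  case/orP=> /orP[] /eqP e; move: c0 c3; rewrite -?e ?cj //; auto.
  by rewrite e cj.
case=> /eqP->.
  apply: (@star_adj _ _ (c (ordS (ordS i)))); rewrite ?M //.
    by move=> e; move: c0; rewrite e M.
  by rewrite !E.
apply: (@star_adj _ _ (c (ordS i))); rewrite ?M //.
  by move=> e; move: c3; rewrite e M.
by rewrite !E.
Qed.

(** c_i would close a triangle with [t] and c_(i+1); c_(i+3) would see neither of these two,
    although they are on opposite sides. *)
Lemma edge_nbrs_KBe_right i t D : t \in edge_nbrs c i ->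
  [/\ t \in val D, c (ordS i) \in val D & c (ordS (ordS i)) \in val D] ->
  D \in @edge_nbrs n (KBe G) B (ordS i).
Proof.
move=> /edge_nbrsP tE [tD c1 c2].
have [f fE] := biclique_colouring D.
have f12 : adj (c (ordS i)) (c (ordS (ordS i))) by rewrite !E.
have ft1 : adj t (c (ordS i)) by rewrite tE !E orbT.
move: (f12) (ft1); rewrite !fE // => h1 h2.
apply: edge_nbrs_KBe => //; apply/negP=> cD.
  have: adj t (c i) by rewrite tE !E.
  have: adj (c i) (c (ordS i)) by rewrite !E.
  by rewrite !fE //; move: h2; case: (f _); case: (f _); case: (f _).
have: ~~ adj t (c (ordS (ordS (ordS i)))) by rewrite tE !E.
have: ~~ adj (c (ordS i)) (c (ordS (ordS (ordS i)))) by rewrite !E.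
by rewrite !fE //; move: h2; case: (f _); case: (f _); case: (f _).
Qed.

Lemma edge_nbrs_KBe_left i t D : t \in edge_nbrs c (ordS (ordS i)) ->
  [/\ t \in val D, c (ordS i) \in val D & c (ordS (ordS i)) \in val D] ->
  D \in @edge_nbrs n (KBe G) B (ordS i).
Proof.
move=> /edge_nbrsP tE [tD c1 c2].
have [f fE] := biclique_colouring D.
have f12 : adj (c (ordS i)) (c (ordS (ordS i))) by rewrite !E.
have ft2 : adj t (c (ordS (ordS i))) by rewrite tE !E.
move: (f12) (ft2); rewrite !fE // => h1 h2.
apply: edge_nbrs_KBe => //; apply/negP=> cD.
  have: ~~ adj t (c i) by rewrite tE !E.
  have: ~~ adj (c i) (c (ordS (ordS i))) by rewrite !E.
  by rewrite !fE //; move: h2; case: (f _); case: (f _); case: (f _).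
have: adj t (c (ordS (ordS (ordS i)))) by rewrite tE !E orbT.
have: adj (c (ordS (ordS i))) (c (ordS (ordS (ordS i)))) by rewrite !E.
by rewrite !fE //; move: h2; case: (f _); case: (f _); case: (f _).
Qed.

Lemma edge_nbrs_KBe_mem i D : D \in @edge_nbrs n (KBe G) B i ->
  c i \in val D /\ c (ordS i) \in val D.
Proof.
rewrite inE => /forallP h.
have /eqP := h (ordS i); rewrite eqxx orbT => /star_adj_mem[h2 _].
by have /eqP := h i; rewrite eqxx => /star_adj_mem[h1 _].
Qed.

(** For the last clause, [Q] contains the nonadjacent c_i and c_(i+3), so one end [b] of an edge
    shared with [T] sees both. Within [T], [b] sees exactly one of c_(i+1), c_(i+2), and either case
    contradicts [good_middle]. *)
Lemma star_strong_cycle : @strong_cycle n (KBe G) B.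
Proof.
split; first exact: star_good_cycle.
  move=> i D D' /edge_nbrs_KBe_mem[h1 h2] /edge_nbrs_KBe_mem[h3 h4] /eqP ne.
  by apply/KBe_adjP; split=> //; exists (c i), (c (ordS i)); rewrite !E.
move=> Q i T /edge_nbrs_KBe_mem[T1 T2] /star_adj_mem[Q0 _] /star_adj_mem[Q3 _].
apply/negP=> /KBe_adjP[_ [u [v [uv uQ vQ uT vT]]]].
have [f fE] := biclique_colouring Q; have [g gE] := biclique_colouring T.
have f03 : ~~ adj (c i) (c (ordS (ordS (ordS i)))) by rewrite !E.
have [b [bT b0 b3]] : exists b,
    [/\ b \in val T, adj b (c i) & adj b (c (ordS (ordS (ordS i))))].
  move: uv f03; rewrite !fE // => uv f03.
  case eu: (f u == f (c i)); [exists v|exists u]; rewrite !fE //; split=> //;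
    move: eu uv f03;
    by case: (f u); case: (f v); case: (f (c _)); case: (f (c _)).
have: adj (c (ordS i)) (c (ordS (ordS i))) by rewrite !E.
have [b1|b1] := boolP (adj b (c (ordS i))).
  have b2 : ~~ adj b (c (ordS (ordS i))).
    apply/negP=> b2; have: adj (c (ordS i)) (c (ordS (ordS i))) by rewrite !E.
    by move: b1 b2; rewrite !gE //; case: (g b); case: (g (c _)); case: (g (c _)).
  have [e|] := good_middle b1 b3; last by rewrite (negbTE b2).
  by move: b0; rewrite e !E.
have [b2|b2] := boolP (adj b (c (ordS (ordS i)))).
  have [e|] := good_middle b0 b2; last by rewrite (negbTE b1).
  by move: b3; rewrite e !E.
by move: b1 b2; rewrite !gE //; case: (g b); case: (g (c _)); case: (g (c _)).
Qed.

End StarFamily.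

End GoodCycle.

(** * Growth of the attached cliques under iteration *)

Lemma card_edge_nbrs_KBe n (G : sgraph) (c : 'I_n -> G) (i : 'I_n) :
  5 <= n -> strong_cycle c ->
  exists B : 'I_n -> KBe G,
    strong_cycle B /\ #|edge_nbrs c i| <= #|edge_nbrs B (ordS i)|.
Proof.
move=> n5 [gc clq _]; have [B BE] := star_family n5 gc.
exists B; split; first exact: (star_strong_cycle n5 gc BE).
have [U Uinj UE] := edge_nbrs_right_fun n5 gc (clq i).
rewrite -(card_in_imset Uinj); apply/subset_leq_card/subsetP=> _ /imsetP[t tT ->].
exact: (edge_nbrs_KBe_right n5 gc BE tT (UE t tT)).
Qed.

Lemma card_edge_nbrs_KBe2 n (G : sgraph) (c : 'I_n -> G) (i : 'I_n) :
  5 <= n -> strong_cycle c ->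
  exists B : 'I_n -> KBe (KBe G),
    strong_cycle B /\ 2 * #|edge_nbrs c i| <= #|edge_nbrs B i|.
Proof.
move=> n5 [gc clq far].
rewrite -[i]ord_predK -[ord_pred i]ord_predK; move: (ord_pred _) => j {i}.
have [B BE] := star_family n5 gc.
have sB : @strong_cycle n (KBe G) B := star_strong_cycle n5 gc BE.
have [gB clqB _] := sB; have [B2 B2E] := star_family n5 gB.
exists B2; split; first exact: (star_strong_cycle n5 gB B2E).
set T := edge_nbrs c _.
pose s1 := ordS j; pose s2 := ordS s1; pose s3 := ordS s2.
have [L Linj LE] := edge_nbrs_left_fun n5 gc (clq s2).
have [R Rinj RE] := edge_nbrs_right_fun n5 gc (clq s2).
have LB t : t \in T -> L t \in @edge_nbrs n (KBe G) B s1.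
  by move=> tT; exact: (edge_nbrs_KBe_left n5 gc BE tT (LE t tT)).
have RB t : t \in T -> R t \in @edge_nbrs n (KBe G) B s3.
  by move=> tT; exact: (edge_nbrs_KBe_right n5 gc BE tT (RE t tT)).
have nLR t t' : t \in T -> t' \in T -> ~~ @adj (KBe G) (L t) (R t').
  move=> tT t'T.
  apply: (edge_nbrs_non_crossing n5 gc _ tT t'T (LE t tT) (RE t' t'T)) => q.
  exact: far.
have [K Kinj KE] := edge_nbrs_right_fun n5 gB (clqB s1).
have [M Minj ME] := edge_nbrs_left_fun n5 gB (clqB s3).
have cardP : #|[set K (L t) | t in T]| = #|T|.
  by apply: card_in_imset => t t' tT t'T /(Kinj _ _ (LB t tT) (LB t' t'T)) /Linj; apply.
have cardQ : #|[set M (R t) | t in T]| = #|T|.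
  by apply: card_in_imset => t t' tT t'T /(Minj _ _ (RB t tT) (RB t' t'T)) /Rinj; apply.
(* In a common biclique, [L t] would be on the side of [B s3] and [R t'] on the side of [B s2];
   these sides are opposite, so [L t] and [R t'] would be adjacent, against [nLR]. *)
have dis : [set K (L t) | t in T] :&: [set M (R t) | t in T] = set0.
  apply/setP=> D; rewrite !inE; apply/negP=> /andP[/imsetP[t tT ->] /imsetP[t' t'T e]].
  have [xD pD qD] := KE _ (LB t tT); have [yD _ _] := ME _ (RB t' t'T).
  rewrite -e in yD; have [f fE] := biclique_colouring (K (L t)).
  have := nLR t t' tT t'T.
  have : @adj (KBe G) (B s2) (B s3) by rewrite (cycle_adj gB) eqxx.
  have : ~~ @adj (KBe G) (L t) (B s3).
    by move/edge_nbrsP: (LB t tT) => ->; rewrite !ordS_eq !(ordSE n5).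
  have : ~~ @adj (KBe G) (R t') (B s2).
    by move/edge_nbrsP: (RB t' t'T) => ->; rewrite !ordS_eq !(ordSE n5).
  by rewrite !fE //; case: (f (L t)); case: (f (R t')); case: (f (B s2)); case: (f (B s3)).
rewrite mul2n -addnn -{1}cardP -cardQ -cardsUI dis cards0 addn0.
apply/subset_leq_card/subsetP=> D; rewrite in_setU => /orP[] /imsetP[t tT ->].
  exact: (edge_nbrs_KBe_right n5 gB B2E (LB t tT) (KE _ (LB t tT))).
exact: (edge_nbrs_KBe_left n5 gB B2E (RB t tT) (ME _ (RB t tT))).
Qed.

Lemma card_edge_nbrs_iter n (G : sgraph) (c : 'I_n -> G) (i : 'I_n) k :
  5 <= n -> strong_cycle c ->
  exists B : 'I_n -> KBe_iter k.*2 G,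
    strong_cycle B /\ 2 ^ k * #|edge_nbrs c i| <= #|edge_nbrs B i|.
Proof.
move=> n5 sc; elim: k => [|k [B [sB cB]]]; first by exists c; rewrite mul1n.
have [B' [sB' cB']] := card_edge_nbrs_KBe2 i n5 sB.
exists B'; split=> //; apply: leq_trans cB'.
by rewrite expnS -mulnA leq_mul2l.
Qed.

Theorem mainTheorem11 (G : sgraph) (n m : nat) :
  5 <= n -> 1 <= m -> has_good_necklace G n m ->
  forall N : nat, exists K : nat, forall k : nat, K <= k ->
    N <= #|vert (KBe_iter k G)|.
Proof.
move=> n5 m1 [c [w [i0 [[cinj _ _] [[cadj _ wadj] cgood]]]]] N.
have gc : good_cycle c by split.
have wE : w (Ordinal m1) \in edge_nbrs c i0.
  by apply/edge_nbrsP=> j; rewrite wadj.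
have [B BE] := star_family n5 gc.
have sB : @strong_cycle n (KBe G) B := star_strong_cycle n5 gc BE.
have B1 : 0 < #|@edge_nbrs n (KBe G) B (ordS i0)|.
  have [D hD] := edge_nbrs_right n5 gc wE.
  apply/card_gt0P; exists D.
  exact: (edge_nbrs_KBe_right n5 gc BE wE hD).
(* Doubling takes two steps, so a second starting point, one step later, serves the other parity of
   k. *)
have [B2 [sB2 cB2]] := card_edge_nbrs_KBe (ordS i0) n5 sB.
have large (H : sgraph) (b : 'I_n -> H) i j : strong_cycle b ->
    0 < #|edge_nbrs b i| -> N <= j -> N <= #|KBe_iter j.*2 H|.
  move=> sb b1 leNj; have [b' [_ cb']] := card_edge_nbrs_iter i j n5 sb.
  apply: leq_trans (leq_trans cb' (max_card _)).
  by rewrite (leq_trans leNj) // (leq_trans (ltnW (ltn_expl j (isT : 1 < 2)))) // leq_pmulr.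
(* One step makes the cycle strong and at most one more fixes the parity; the remaining N or more
   double steps suffice because N < 2^N. *)
exists N.*2.+2 => -[//|k lek].
have leN : N <= k./2 by rewrite -[N](doubleK N) half_leq // ltnW.
rewrite /KBe_iter iterSr -(odd_double_half k).
case: (odd k); last exact: large sB B1 leN.
by rewrite add1n iterSr; apply: large sB2 (leq_trans B1 cB2) leN.
Qed.
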